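(* Let $u\in\mathbb{C}$ and let $\Phi_n$ be the monic orthogonal polynomials on the unit circle with respect to the weight function $w(\theta)=e^{2|u|\sin(\theta+\arg(u))}$, $\theta\in[0,2\pi]$. Then, for $n\ge1$, $$z^2\Phi_n'(z)=[(n-i\overline u\,\alpha_n\overline{\alpha}_{n-1})z+i\overline u]\Phi_n(z)+[iu\overline{\alpha}_nz+i\overline u\,\overline{\alpha}_{n-1}]\Phi_n^*(z),$$ $$z(\Phi_n^* )'(z)=i[u\alpha_{n-1}z+\overline u\,\alpha_n]\Phi_n(z)+iu[z-\overline{\alpha}_n\alpha_{n-1}]\Phi_n^*(z).$$
   Context: The monic orthogonal polynomials $\Phi_n$ ($\deg\Phi_n=n$) are orthogonal for $\langle f,g\rangle=\int_0^{2\pi}f(e^{i\theta})\overline{g(e^{i\theta})}\,w(\theta)\,d\theta$. Reversed polynomial: $\Phi_n^*(z)=z^n\overline{\Phi_n(1/\overline z)}$. Verblunsky coefficients: $\alpha_{n-1}=-\overline{\Phi_n(0)}$ for $n\ge1$, and $\alpha_{-1}=-1$. Prime denotes $d/dz$. When $u=0$ the weight is $w\equiv1$. *)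

(* Defs.v *)
From HB Require Import structures.
From mathcomp Require Import all_boot all_order all_algebra.
From mathcomp Require Import all_classical all_reals all_analysis.
From mathcomp Require Export complex.
Set Implicit Arguments.
Unset Strict Implicit.
Unset Printing Implicit Defensive.
Import Order.TTheory GRing.Theory Num.Theory ComplexField.Normc.
Local Open Scope ring_scope.

(* Principal argument, in ]-pi, pi].  The value at 0 is an artefact of
   division by zero; the weight below does not depend on it, since there it is
   multiplied by normc u = 0. *)
Definition carg (R : realType) (u : R[i]) : R :=
  if 0 <= complex.Im u then acos (complex.Re u / normc u) else - acos (complex.Re u / normc u).

Definition weight (R : realType) (u : R[i]) (theta : R) : R :=
  expR (2 * normc u * sin (theta + carg u)).

Definition cexpi (R : realType) (theta : R) : R[i] := (cos theta +i* sin theta)%C.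

Definition circle_int (R : realType) (F : R -> R[i]) : R[i] :=
  (\int[lebesgue_measure]_(t in `[0%R, 2 * pi]%classic) complex.Re (F t)
   +i* \int[lebesgue_measure]_(t in `[0%R, 2 * pi]%classic) complex.Im (F t))%C.

Definition inner (R : realType) (w : R -> R) (f g : {poly R[i]}) : R[i] :=
  circle_int (fun t => f.[cexpi t] * (g.[cexpi t])^* * (w t)%:C%C).

Definition monic_OPUC (R : realType) (w : R -> R) (Phi : nat -> {poly R[i]}) :
    Prop :=
  (forall n, Phi n \is monic /\ size (Phi n) = n.+1) /\
  (forall m n, m <> n -> inner w (Phi m) (Phi n) = 0).

(* The degree-n reversal as a polynomial; reversedE shows that it is
   z |-> z^n * conj (p (1 / conj z)). *)
Definition reversed (R : realType) (n : nat) (p : {poly R[i]}) : {poly R[i]} :=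
  \poly_(k < n.+1) (p`_(n - k))^*.

(* alpha_k for k >= 0; the remaining one, alpha_{-1} = -1, is given by the same
   formula, since Phi_0 = 1. *)
Definition verblunsky (R : realType) (Phi : nat -> {poly R[i]}) (k : nat) :
    R[i] :=
  - ((Phi k.+1).[0])^*.

Lemma reversedE (R : realType) (n : nat) (p : {poly R[i]}) (z : R[i]) :
  (size p <= n.+1)%N -> z != 0 ->
  (reversed n p).[z] = z ^+ n * (p.[1 / z^*])^*.
Proof.
move=> sp z0; rewrite /reversed horner_poly (horner_coef_wide _ sp).
rewrite rmorph_sum /= big_distrr /= (reindex_inj rev_ord_inj) /=.
apply: eq_bigr => k _; rewrite subSS subKn -1?ltnS // rmorphM rmorphXn /=.
rewrite div1r fmorphV /= conjCK mulrCA; congr (_ * _).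
by rewrite exprB ?unitfE -1?ltnS // exprVn.
Qed.

Lemma cexpi_carg (R : realType) (u : R[i]) :
  u = (normc u)%:C%C * cexpi (carg u).
Proof.
have [->|u0] := eqVneq u 0.
  by rewrite normc0 mul0r.
have r2 : normc u ^+ 2 = complex.Re u ^+ 2 + complex.Im u ^+ 2.
  by case: (u) => a b /=; rewrite sqr_sqrtr // addr_ge0 // sqr_ge0.
have r0 : 0 < normc u.
  have r_ge0 : 0 <= normc u by case: (u) => a b; rewrite sqrtr_ge0.
  rewrite lt_neqAle r_ge0 andbT eq_sym.
  by apply: contraNneq u0 => /eq0_normc ->.
have uE : (complex.Re u +i* complex.Im u)%C = u by case: (u).
rewrite -{1}uE /carg; move: (normc u) r2 r0 => r.
move: (complex.Re u) (complex.Im u) => x y r2 r0.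
have rN0 : r != 0 by rewrite gt_eqF.
have c1 : -1 <= x / r <= 1.
  rewrite -ler_norml -(@ler_pXn2r _ 2) ?nnegrE // expr1n real_normK ?num_real //.
  by rewrite expr_div_n ler_pdivrMr ?exprn_gt0 // mul1r r2 lerDl sqr_ge0.
have s : Num.sqrt (1 - (x / r) ^+ 2) = `|y| / r.
  rewrite -[RHS]ger0_norm ?divr_ge0 ?(ltW r0) // -sqrtr_sqr.
  congr Num.sqrt; rewrite !expr_div_n real_normK ?num_real //.
  apply: (@mulIf _ (r ^+ 2)); first by rewrite expf_neq0.
  by rewrite mulrBl !divfK ?expf_neq0 // mul1r r2 addrAC subrr add0r.
set t := (if _ then _ else _).
have cosE : cos t = x / r by rewrite /t; case: ifP; rewrite ?cosN acosK.
have sinE : sin t = y / r.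
  rewrite /t; case: ifP => [y0|/negbT]; first by rewrite sin_acos // s ger0_norm.
  by rewrite -ltNge => y0; rewrite sinN sin_acos // s ltr0_norm // mulNr opprK.
rewrite /cexpi cosE sinE /GRing.mul /= !mul0r subr0 addr0.
by congr (_ +i* _)%C; rewrite mulrC divfK.
Qed.

(* Main.v *)
(** With z = e^{it} and D = z d/dz, the weight satisfies
    dw/dt = (u z + conj(u) / z) w, so integration by parts over the circle gives
      <D f, g> = <f, D g> + i (u <z f, g> + conj(u) <f, z g>).
    Applied to f = g = Phi_n it shows that u conj(alpha_n) alpha_{n-1} is purely
    imaginary.  A polynomial of degree <= n that vanishes at 0 and is orthogonal
    to z, ..., z^n is zero: this yields the Szego recursion, and also both
    identities, since by the integration by parts formula with g = z^k the
    difference of their two sides satisfies these conditions (the vanishing of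
    the coefficient of z^(n+1), respectively z^0, is the imaginarity above). *)

Require Import Defs.
From mathcomp Require Import all_boot all_order all_algebra.
From mathcomp Require Import all_classical all_reals all_analysis.
From mathcomp Require Import complex ring zify.

Set Implicit Arguments.
Unset Strict Implicit.
Unset Printing Implicit Defensive.
Import Order.TTheory GRing.Theory Num.Theory ComplexField.Normc.
Import numFieldNormedType.Exports.
Local Open Scope classical_set_scope.
Local Open Scope ring_scope.

(** * Calculus of complex-valued functions of a real variable and their integrals over the circle *)

Section ComplexCurves.
Variable R : realType.
Implicit Types (F G H : R -> R[i]) (c d : R[i]) (f : R -> R).

(** Continuity and differentiation are componentwise, like [circle_int], so that the real theory of
    integration applies to each component directly. *)
Definition ccontinuous F : Prop :=
  continuous (fun t => complex.Re (F t)) /\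
  continuous (fun t => complex.Im (F t)).

Definition cderive F G : Prop := forall t : R,
  is_derive t 1 (fun x => complex.Re (F x)) (complex.Re (G t)) /\
  is_derive t 1 (fun x => complex.Im (F x)) (complex.Im (G t)).

Lemma Re_mul c d :
  complex.Re (c * d) = complex.Re c * complex.Re d - complex.Im c * complex.Im d.
Proof. by case: c; case: d. Qed.

Lemma Im_mul c d :
  complex.Im (c * d) = complex.Re c * complex.Im d + complex.Im c * complex.Re d.
Proof. by case: c; case: d. Qed.

Lemma Re_add c d : complex.Re (c + d) = complex.Re c + complex.Re d.
Proof. by case: c; case: d. Qed.

Lemma Im_add c d : complex.Im (c + d) = complex.Im c + complex.Im d.
Proof. by case: c; case: d. Qed.

Lemma Re_conjc c : complex.Re c^* = complex.Re c.
Proof. by case: c. Qed.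

Lemma Im_conjc c : complex.Im c^* = - complex.Im c.
Proof. by case: c. Qed.

Definition ReImE := (Re_mul, Im_mul, Re_add, Im_add, Re_conjc, Im_conjc).

Lemma is_derive_continuous f (df : R -> R) :
  (forall t : R, is_derive t 1 f (df t)) -> continuous f.
Proof.
move=> dfE x; apply/differentiable_continuous/derivable1_diffP.
by apply: ex_derive; exact: dfE.
Qed.

Lemma cderive_continuous F G : cderive F G -> ccontinuous F.
Proof.
move=> dF; split; first exact: is_derive_continuous (fun t => (dF t).1).
exact: is_derive_continuous (fun t => (dF t).2).
Qed.

Lemma ccontinuousD F G :
  ccontinuous F -> ccontinuous G -> ccontinuous (fun t => F t + G t).
Proof.
move=> [F1 F2] [G1 G2]; split=> t.
- by under eq_fun do rewrite Re_add; apply: cvgD; [exact: F1|exact: G1].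
- by under eq_fun do rewrite Im_add; apply: cvgD; [exact: F2|exact: G2].
Qed.

Lemma ccontinuousM F G :
  ccontinuous F -> ccontinuous G -> ccontinuous (fun t => F t * G t).
Proof.
move=> [F1 F2] [G1 G2]; split=> t.
- under eq_fun do rewrite Re_mul.
  by apply: cvgB; apply: cvgM; [exact: F1|exact: G1|exact: F2|exact: G2].
- under eq_fun do rewrite Im_mul.
  by apply: cvgD; apply: cvgM; [exact: F1|exact: G2|exact: F2|exact: G1].
Qed.

Lemma ccontinuous_conj F : ccontinuous F -> ccontinuous (fun t => (F t)^*).
Proof.
move=> [F1 F2]; split=> t; first by under eq_fun do rewrite Re_conjc; exact: F1.
by under eq_fun do rewrite Im_conjc; apply: cvgN; exact: F2.
Qed.

Lemma ccontinuous_real f : continuous f -> ccontinuous (fun t => (f t)%:C%C).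
Proof. by move=> cf; split=> //= t; exact: cvg_cst. Qed.

Lemma cderive_ext F G H : (forall t, G t = H t) -> cderive F G -> cderive F H.
Proof. by move=> GH dF t; rewrite -GH. Qed.

Lemma cderive_cst c : cderive (fun=> c) (fun=> 0).
Proof. by move=> t; split; exact: is_derive_cst. Qed.

Lemma cderiveD F F' G G' : cderive F F' -> cderive G G' ->
  cderive (fun t => F t + G t) (fun t => F' t + G' t).
Proof.
move=> dF dG t; have [F1 F2] := dF t; have [G1 G2] := dG t.
split.
- by under eq_fun do rewrite Re_add; rewrite Re_add; exact: is_deriveD.
- by under eq_fun do rewrite Im_add; rewrite Im_add; exact: is_deriveD.
Qed.

Lemma cderiveM F F' G G' : cderive F F' -> cderive G G' ->
  cderive (fun t => F t * G t) (fun t => F' t * G t + F t * G' t).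
Proof.
move=> dF dG t; have [F1 F2] := dF t; have [G1 G2] := dG t.
split.
- under eq_fun do rewrite Re_mul.
  apply: is_derive_eq (is_deriveB (is_deriveM F1 G1) (is_deriveM F2 G2)) _.
  by rewrite Re_add !Re_mul /GRing.scale /=; ring.
- under eq_fun do rewrite Im_mul.
  apply: is_derive_eq (is_deriveD (is_deriveM F1 G2) (is_deriveM F2 G1)) _.
  by rewrite Im_add !Im_mul /GRing.scale /=; ring.
Qed.

Lemma cderive_conj F F' : cderive F F' ->
  cderive (fun t => (F t)^*) (fun t => (F' t)^*).
Proof.
move=> dF t; have [F1 F2] := dF t; split.
- by under eq_fun do rewrite Re_conjc; rewrite Re_conjc.
- by under eq_fun do rewrite Im_conjc; rewrite Im_conjc; exact: is_deriveN.
Qed.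

Lemma cderive_real f (df : R -> R) : (forall t : R, is_derive t 1 f (df t)) ->
  cderive (fun t => (f t)%:C%C) (fun t => (df t)%:C%C).
Proof. by move=> dfE t; split; [exact: dfE|exact: is_derive_cst]. Qed.

Lemma cderive_cexpi : cderive (@cexpi R) (fun t => 'i * cexpi t).
Proof.
by move=> t; rewrite -complexiE; split=> /=; apply: is_derive_eq;
  rewrite ?mul0r ?mul1r ?sub0r ?add0r.
Qed.

(** Along the circle d/dt acts as i z d/dz, an operator that keeps polynomials polynomial and does
    not raise their degree. *)
Lemma cderive_horner (p : {poly R[i]}) :
  cderive (fun t => p.[cexpi t]) (fun t => 'i * ('X * p^`()).[cexpi t]).
Proof.
elim/poly_ind: p => [|p c IH].
  under eq_fun do rewrite horner0.
  by apply: cderive_ext (cderive_cst 0) => t; rewrite deriv0 mulr0 horner0 mulr0.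
under eq_fun do rewrite hornerD hornerM hornerX hornerC.
apply: cderive_ext (cderiveD (cderiveM IH cderive_cexpi) (cderive_cst c)) => t.
by rewrite derivD derivM derivX derivC !(hornerD, hornerM, hornerX, hornerC); ring.
Qed.

Lemma cexpiD (a b : R) : cexpi (a + b) = cexpi a * cexpi b.
Proof.
rewrite /cexpi cosD sinD; apply/eqP; rewrite eq_complex /= eqxx /=.
by apply/eqP; ring.
Qed.

Lemma cexpi_unit (t : R) : cexpi t * (cexpi t)^* = 1.
Proof.
apply/eqP; rewrite eq_complex Re_mul Im_mul Re_conjc Im_conjc /=.
by rewrite -(cos2Dsin2 t); apply/andP; split; apply/eqP; ring.
Qed.

Lemma cexpi_neq0 (t : R) : cexpi t != 0.
Proof.
apply/negP => /eqP z0; have := cexpi_unit t.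
by rewrite z0 mul0r => /esym/eqP; rewrite oner_eq0.
Qed.

Lemma cexpi2pi : cexpi (2 * pi) = cexpi 0 :> R[i].
Proof. by rewrite /cexpi mulr_natl cos2pi sin2pi cos0 sin0. Qed.

Lemma integrable_continuous f (a b : R) : continuous f ->
  (@lebesgue_measure R).-integrable `[a, b] (EFin \o f).
Proof.
move=> cf; apply: continuous_compact_integrable; first exact: segment_compact.
exact: continuous_subspaceT.
Qed.

Lemma circle_intD F G : ccontinuous F -> ccontinuous G ->
  circle_int (fun t => F t + G t) = circle_int F + circle_int G.
Proof.
move=> [F1 F2] [G1 G2]; rewrite /circle_int.
under eq_Rintegral do rewrite Re_add.
under [X in (_ +i* X)%C]eq_Rintegral do rewrite Im_add.
by rewrite !RintegralD //; exact: integrable_continuous.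
Qed.

Lemma circle_intZ c F : ccontinuous F ->
  circle_int (fun t => c * F t) = c * circle_int F.
Proof.
move=> [F1 F2]; rewrite /circle_int.
under eq_Rintegral do rewrite Re_mul.
under [X in (_ +i* X)%C]eq_Rintegral do rewrite Im_mul.
have cZ (r : R) f : continuous f -> continuous (fun t => r * f t).
  by move=> cf t; apply: cvgM; [exact: cvg_cst|exact: cf].
rewrite RintegralB ?RintegralD //; try by apply/integrable_continuous/cZ.
rewrite !RintegralZl //; try exact: integrable_continuous.
by case: (c).
Qed.

Lemma circle_int_conj F : ccontinuous F ->
  circle_int (fun t => (F t)^*) = (circle_int F)^*.
Proof.
move=> [F1 F2]; rewrite /circle_int.
under eq_Rintegral do rewrite Re_conjc.
under [X in (_ +i* X)%C]eq_Rintegral do rewrite Im_conjc -mulN1r.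
rewrite !RintegralZl //; try exact: integrable_continuous.
by rewrite mulN1r.
Qed.

Lemma Rintegral_is_derive f (df : R -> R) (a b : R) : a < b ->
  (forall t : R, is_derive t 1 f (df t)) -> continuous df ->
  \int[lebesgue_measure]_(t in `[a, b]) df t = f b - f a.
Proof.
move=> ab dfE cdf; have cf := is_derive_continuous dfE.
rewrite /Rintegral (continuous_FTC2 (F := f) ab) //=.
- exact: continuous_subspaceT.
- split=> [x _| |]; first by apply: ex_derive; exact: dfE.
  + by apply: cvg_at_right_filter; exact: cf.
  + by apply: cvg_at_left_filter; exact: cf.
- by move=> x _; rewrite derive1E; apply: derive_val; exact: dfE.
Qed.

Lemma circle_int_cderive F G : cderive F G -> ccontinuous G ->
  F (2 * pi) = F 0 -> circle_int G = 0.
Proof.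
move=> dF [G1 G2] F0; rewrite /circle_int.
have pi0 : (0 : R) < 2 * pi by rewrite mulr_gt0 // pi_gt0.
rewrite (Rintegral_is_derive pi0 (fun t => (dF t).1) G1).
rewrite (Rintegral_is_derive pi0 (fun t => (dF t).2) G2).
by rewrite F0 !subrr.
Qed.

(** A nonnegative function with zero integral vanishes almost everywhere. A nonzero value at an
    interior point would persist on a ball inside the interval, and a null set contains no ball. *)
Lemma Rintegral_continuous_eq0 f (a b : R) : continuous f ->
  (forall t, 0 <= f t) ->
  \int[lebesgue_measure]_(t in `[a, b]) f t = 0 ->
  {in `]a, b[, forall t, f t = 0}.
Proof.
move=> cf f0 intf t tab; apply/eqP/negPn/negP => ft.
have iE := integrable_continuous a b cf.
have : ae_eq (@lebesgue_measure R) `[a, b]%classic (EFin \o f) (cst 0%E).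
  apply/ae_eq_integral_abs => //; first exact: measurable_int iE.
  under eq_integral do rewrite /= ger0_norm //.
  (* The real integral is [fine] of the extended one, and [fine] also sends the infinities to 0;
     finiteness is what lets [intf] be lifted. *)
  have fin : (\int[@lebesgue_measure R]_(x in `[a, b]) (f x)%:E)%E \is a fin_num.
    exact: integrable_fin_num iE.
  by rewrite -(fineK fin); congr (_%:E).
case=> A [mA A0 sA].
have : \forall x \near t, (x \in `]a, b[) /\ f x != 0.
  near=> x; split; near: x; first exact: near_in_itvoo.
  exact: (cvgr_neq0 (f t) (cf t) ft).
move=> /nbhs_ballP [e /= e0 sB].
have : (@lebesgue_measure R (ball t e) <= @lebesgue_measure R A)%E.
  apply: le_measure; rewrite ?inE //; first exact: measurable_realfun.measurable_ball.
  move=> x /sB[xab fx]; apply: sA => /= fx0.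
  have [] : `[a, b]%classic x /\ f x <> 0.
    split; last exact/eqP.
    by move: xab; rewrite /= !in_itv /= => /andP[/ltW -> /ltW ->].
  by move=> /fx0 [->].
by rewrite A0 (lebesgue_measure_ball _ (ltW e0)) lee_fin pmulrn_rle0 // leNgt e0.
Unshelve. all: by end_near.
Qed.

End ComplexCurves.

(** * Reversed polynomials *)

Section Reversed.
Variable R : realType.
Implicit Types (f g : {poly R[i]}) (n k : nat).

Lemma coef_reversed n f k :
  (reversed n f)`_k = if (k <= n)%N then (f`_(n - k))^* else 0.
Proof. by rewrite coef_poly ltnS. Qed.

Lemma size_reversed n f : (size (reversed n f) <= n.+1)%N.
Proof. exact: size_poly. Qed.

Lemma reversedXn n k : (k <= n)%N ->
  reversed n 'X^k = 'X^(n - k) :> {poly R[i]}.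
Proof.
move=> kn; apply/polyP => j; rewrite coef_reversed !coefXn.
case: leqP => jn; last by case: eqP => // jE; lia.
by rewrite conjC_nat; congr (_%:R); congr nat_of_bool; lia.
Qed.

Lemma reversedXM n f : (size f <= n.+1)%N ->
  reversed n.+1 ('X * f) = reversed n f.
Proof.
move=> sf; apply/polyP => j; rewrite !coef_reversed coefXM.
have [jn|jn] := leqP j n.
  by rewrite leqW // subn_eq0 leqNgt ltnS jn /= subSn.
by case: leqP => // jn1; rewrite (_ : (n.+1 - j = 0)%N) /= ?rmorph0 //; lia.
Qed.

(** On the unit circle 1 / conj z = z, so [reversedE] evaluates f at the point itself. *)
Lemma horner_reversed n f (t : R) : (size f <= n.+1)%N ->
  (reversed n f).[cexpi t] = cexpi t ^+ n * (f.[cexpi t])^*.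
Proof.
move=> sf; rewrite reversedE ?cexpi_neq0 //; congr (_ * (f.[_])^*).
by apply: (canLR (mulfK _)); rewrite ?conjC_eq0 ?cexpi_neq0 // cexpi_unit.
Qed.

End Reversed.

(** * The inner product of a continuous weight *)

Section Inner.
Variables (R : realType) (w : R -> R).
Hypothesis cw : continuous w.
Implicit Types (f g h : {poly R[i]}) (c : R[i]).

Lemma ccontinuous_inner f g :
  ccontinuous (fun t => f.[cexpi t] * (g.[cexpi t])^* * (w t)%:C%C).
Proof.
have ch h : ccontinuous (fun t => h.[cexpi t]) :=
  cderive_continuous (cderive_horner h).
apply: ccontinuousM (ccontinuous_real cw).
by apply: ccontinuousM (ch f) (ccontinuous_conj (ch g)).
Qed.

Lemma innerDl f g h : inner w (f + g) h = inner w f h + inner w g h.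
Proof.
rewrite -circle_intD; do ?exact: ccontinuous_inner.
by congr circle_int; apply/funext => t; rewrite hornerD; ring.
Qed.

Lemma innerZl c f g : inner w (c *: f) g = c * inner w f g.
Proof.
rewrite -circle_intZ; last exact: ccontinuous_inner.
by congr circle_int; apply/funext => t; rewrite hornerZ; ring.
Qed.

Lemma innerC f g : (inner w f g)^* = inner w g f.
Proof.
rewrite -circle_int_conj; last exact: ccontinuous_inner.
congr circle_int; apply/funext => t; rewrite !rmorphM /= conjCK.
by congr (_ * _); [exact: mulrC|exact: conjc_real].
Qed.

Lemma innerBl f g h : inner w (f - g) h = inner w f h - inner w g h.
Proof. by rewrite -scaleN1r innerDl innerZl mulN1r. Qed.

Lemma innerDr f g h : inner w f (g + h) = inner w f g + inner w f h.
Proof. by rewrite -innerC innerDl rmorphD /= !innerC. Qed.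

Lemma innerZr c f g : inner w f (c *: g) = c^* * inner w f g.
Proof. by rewrite -innerC innerZl rmorphM /= innerC. Qed.

Lemma inner0r f : inner w f 0 = 0.
Proof. by rewrite -(scale0r 0) innerZr rmorph0 mul0r. Qed.

Lemma inner_sumr f g :
  inner w f g = \sum_(k < size g) (g`_k)^* * inner w f 'X^k.
Proof.
rewrite -{1}(coefK g) poly_def.
rewrite (big_morph (inner w f) (innerDr f) (inner0r f)).
by apply: eq_bigr => k _; rewrite innerZr.
Qed.

Lemma innerXX f g : inner w ('X * f) ('X * g) = inner w f g.
Proof.
congr circle_int; apply/funext => t; rewrite !hornerM hornerX rmorphM /=.
rewrite mulrACA cexpi_unit; ring.
Qed.

(** Reversal is antiunitary: on the circle it is conjugation up to the factor z^n of modulus 1,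
    which cancels between the two arguments. *)
Lemma inner_reversed n f g : (size f <= n.+1)%N -> (size g <= n.+1)%N ->
  inner w (reversed n f) (reversed n g) = inner w g f.
Proof.
move=> sf sg; congr circle_int; apply/funext => t.
rewrite !horner_reversed // rmorphM /= conjCK mulrACA.
rewrite rmorphXn /= -exprMn cexpi_unit expr1n mul1r; ring.
Qed.

(** The integrand |f|^2 w is continuous and nonnegative, so f vanishes on an arc and has more roots
    than its degree allows. *)
Lemma inner_eq0 f : (forall t, 0 < w t) -> inner w f f = 0 -> f = 0.
Proof.
move=> w0 ff0; apply/eqP/negPn/negP => f0.
have sqE t : complex.Re (f.[cexpi t] * (f.[cexpi t])^* * (w t)%:C%C) =
    (complex.Re f.[cexpi t] ^+ 2 + complex.Im f.[cexpi t] ^+ 2) * w t.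
  by rewrite !Re_mul Im_mul Re_conjc Im_conjc /=; ring.
have zero : {in `]0, 2 * pi[, forall t : R, f.[cexpi t] = 0}.
  move=> t t02; have [cRe _] := ccontinuous_inner f f.
  have ge0 s : 0 <= complex.Re (f.[cexpi s] * (f.[cexpi s])^* * (w s)%:C%C).
    by rewrite sqE mulr_ge0 ?addr_ge0 ?sqr_ge0 // ltW.
  have int0 := congr1 (@complex.Re R) ff0.
  have /eqP := Rintegral_continuous_eq0 cRe ge0 int0 t02.
  rewrite sqE mulf_eq0 (gt_eqF (w0 t)) orbF.
  by rewrite paddr_eq0 ?sqr_ge0 // !sqrf_eq0 => H; apply/eqP; rewrite eq_complex.
(* The points exp(i/(k+1)) have arguments in ]0, 1], inside the interval where f is known to vanish.
   They are distinct because cos is injective on [0, pi], and [size f] of them already exceed the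
   degree. *)
pose s := mkseq (fun k => @cexpi R k.+1%:R^-1) (size f).
have inv01 k : 0 < (k.+1%:R^-1 : R) <= 1.
  by rewrite invr_gt0 ltr0n /= invf_le1 ?ler1n ?ltr0n.
have pi1 : (1 : R) <= pi by rewrite (le_trans _ (pi_ge2 R)) // ler1n.
have rs : all (root f) s.
  apply/allP => _ /mapP[k _ ->]; apply/rootP/zero; rewrite in_itv /=.
  have /andP[-> k1] := inv01 k; apply: le_lt_trans k1 _.
  by rewrite mulr_natl mulr2n ltr_pwDl // (lt_le_trans _ pi1).
have us : uniq s.
  have itv k : (k.+1%:R^-1 : R) \in `[0, pi].
    by have /andP[k0 k1] := inv01 k; rewrite in_itv /= (ltW k0) (le_trans k1 pi1).
  apply/(mkseq_uniqP (fun k => @cexpi R k.+1%:R^-1)) => j k _ _ jk.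
  have := congr1 (@complex.Re R) jk => /= /cos_inj.
  by move=> /(_ (itv j) (itv k))/invr_inj/eqP; rewrite eqr_nat => /eqP[].
by have := max_poly_roots f0 rs us; rewrite size_mkseq ltnn.
Qed.

End Inner.

(** * The weight and integration by parts *)

Section Weight.
Variables (R : realType) (u : R[i]).
Implicit Types f g : {poly R[i]}.

Lemma weight_gt0 t : 0 < weight u t.
Proof. exact: expR_gt0. Qed.

Lemma is_derive_weight (t : R) :
  is_derive t 1 (weight u)
    (2 * normc u * cos (t + carg u) * weight u t).
Proof.
have -> : weight u = expR \o ((2 * normc u) \*: (@sin R \o (id + cst (carg u)))).
  by [].
apply: is_derive_eq.
rewrite /GRing.scale /= /weight addr0 mulr1; ring.
Qed.

(** The factor 2 |u| cos(t + arg u) is twice the real part of u z. Split as u z plus its conjugate,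
    it can be absorbed into the two arguments of the inner product. *)
Lemma cderive_weight :
  cderive (fun t => (weight u t)%:C%C)
    (fun t => (u * cexpi t + (u * cexpi t)^*) * (weight u t)%:C%C).
Proof.
apply: cderive_ext (cderive_real is_derive_weight) => t /=.
have -> : u * cexpi t = (normc u)%:C%C * cexpi (t + carg u).
  by rewrite {1}(cexpi_carg u) cexpiD mulrAC mulrA.
apply/eqP; rewrite eq_complex !ReImE /=; apply/andP; split; apply/eqP; ring.
Qed.

Lemma continuous_weight : continuous (weight u).
Proof. exact: is_derive_continuous is_derive_weight. Qed.

(** The derivative of f conj(g) w integrates to zero over a period. The product rule gives i <D f,
    g>, then -i <f, D g> with the sign due to conjugation, and the term in w', where u z goes to the
    first argument and its conjugate to the second. *)
Lemma inner_weight_ibp f g :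
  inner (weight u) ('X * f^`()) g = inner (weight u) f ('X * g^`())
    + 'i * (u * inner (weight u) ('X * f) g + u^* * inner (weight u) f ('X * g)).
Proof.
pose I p q t := p.[cexpi t] * (q.[cexpi t])^* * (weight u t)%:C%C.
have cI c p q : ccontinuous (fun t => c * I p q t).
  apply: ccontinuousM (ccontinuous_inner continuous_weight p q).
  exact: cderive_continuous (cderive_cst c).
pose c1 := cI 'i ('X * f^`()) g; pose c2 := cI (- 'i) f ('X * g^`()).
pose c3 := cI u ('X * f) g; pose c4 := cI u^* f ('X * g).
have c12 := ccontinuousD c1 c2; have c34 := ccontinuousD c3 c4.
have dI : cderive (I f g) (fun t =>
    'i * I ('X * f^`()) g t + - 'i * I f ('X * g^`()) t
    + (u * I ('X * f) g t + u^* * I f ('X * g) t)).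
  apply: cderive_ext (cderiveM (cderiveM (cderive_horner f)
    (cderive_conj (cderive_horner g))) cderive_weight) => t.
  rewrite /I !rmorphM /= conjCi !hornerM hornerX !rmorphM /=; ring.
have per : I f g (2 * pi) = I f g 0.
  have [cosE sinE] := cexpi2pi R.
  by rewrite /I cexpi2pi /weight !sinD cosE sinE.
have := circle_int_cderive dI (ccontinuousD c12 c34) per.
rewrite (circle_intD c12 c34) (circle_intD c1 c2) (circle_intD c3 c4).
have iI c p q : circle_int (fun t => c * I p q t) = c * inner (weight u) p q.
  exact: circle_intZ (ccontinuous_inner continuous_weight p q).
(* Multiplying the vanishing integral by i gives A the coefficient -1, so that adding the relation
   to A leaves the right-hand side. *)
rewrite !iI; set A := inner _ _ g; set B := inner _ f _.
set C := inner _ _ g; set D := inner _ f _ => /(congr1 ( *%R 'i)).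
have i2 : 'i * 'i = -1 :> R[i] by rewrite -expr2 sqrCi.
rewrite mulr0 !mulrDr !mulrA mulrN i2 opprK mulN1r mul1r => H.
rewrite -[LHS]addr0 -H; ring.
Qed.

End Weight.

(** * Orthogonality relations and the Szego recursion for a positive continuous weight *)

Section OPUC.
Variables (R : realType) (w : R -> R) (Phi : nat -> {poly R[i]}).
Hypotheses (cw : continuous w) (w_gt0 : forall t, 0 < w t).
Hypothesis hPhi : monic_OPUC w Phi.
Implicit Types (P : {poly R[i]}) (n k : nat).

Local Notation S n := (reversed n (Phi n)).
Local Notation alpha := (verblunsky Phi).
Local Notation h n := (inner w (Phi n) (Phi n)).

Lemma size_Phi n : size (Phi n) = n.+1.
Proof. by case: hPhi => /(_ n)[]. Qed.

Lemma coef_Phi_lead n : (Phi n)`_n = 1.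
Proof. by case: hPhi => /(_ n)[/monicP + sz]; rewrite /lead_coef sz. Qed.

Lemma coef0_Phi n : (Phi n.+1)`_0 = - (alpha n)^*.
Proof. by rewrite /verblunsky horner_coef0 rmorphN /= conjCK opprK. Qed.

Lemma coef0_S n : (S n)`_0 = 1.
Proof. by rewrite coef_reversed subn0 coef_Phi_lead conjC1. Qed.

Lemma coef_S_last n : (S n.+1)`_n.+1 = - alpha n.
Proof. by rewrite coef_reversed leqnn subnn coef0_Phi rmorphN /= conjCK. Qed.

Lemma size_sub_lead n P : (size P <= n.+1)%N ->
  (size (P - P`_n *: Phi n)%R <= n)%N.
Proof.
move=> sP; apply/leq_sizeP => j; rewrite coefB coefZ leq_eqVlt.
move=> /orP[/eqP <-|nj]; first by rewrite coef_Phi_lead mulr1 subrr.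
rewrite (nth_default 0 (s := P) (n := j)) ?(leq_trans sP) //.
by rewrite (nth_default 0 (s := Phi n) (n := j)) ?size_Phi // mulr0 subr0.
Qed.

(** The family is triangular: subtracting the top coefficient times [Phi m] lowers the degree, and
    the subtracted term is orthogonal to [Phi n] since m < n. *)
Lemma inner_Phi_lower n P : (size P <= n)%N -> inner w (Phi n) P = 0.
Proof.
suff H m : (m <= n)%N -> (size P <= m)%N -> inner w (Phi n) P = 0 by exact: H.
elim: m P => [|m IH] P mn sP.
  by move: sP; rewrite size_poly_leq0 => /eqP ->; rewrite inner0r.
rewrite -(subrK (P`_m *: Phi m) P) innerDr // innerZr // hPhi.2; last by lia.
by rewrite mulr0 addr0 IH ?size_sub_lead // ltnW.
Qed.

Lemma inner_Phi_Xn n k : (k < n)%N -> inner w (Phi n) 'X^k = 0.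
Proof. by move=> kn; apply: inner_Phi_lower; rewrite size_polyXn. Qed.

Lemma inner_Phi_lead n P : (size P <= n.+1)%N ->
  inner w (Phi n) P = (P`_n)^* * h n.
Proof.
move=> sP; rewrite -{1}(subrK (P`_n *: Phi n) P) innerDr // innerZr //.
by rewrite inner_Phi_lower ?add0r // size_sub_lead.
Qed.

Lemma inner_Phi_Xlast n : inner w (Phi n) 'X^n = h n.
Proof. by rewrite inner_Phi_lead ?size_polyXn // coefXn eqxx conjC1 mul1r. Qed.

(** Reversal in degree n is antiunitary and exchanges X^k with X^(n-k). Orthogonality of [Phi n] to
    1, ..., X^(n-1) thus becomes orthogonality of [S n] to X, ..., X^n. *)
Lemma inner_S_Xn n k : (k <= n)%N ->
  inner w (S n) 'X^k = (inner w (Phi n) 'X^(n - k))^*.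
Proof.
move=> kn; rewrite -{1}(subKn kn) -reversedXn ?leq_subr // inner_reversed //.
- by rewrite innerC.
- by rewrite size_Phi.
- by rewrite size_polyXn ltnS leq_subr.
Qed.

Lemma inner_S_X0 n : inner w (S n) 'X^0 = h n.
Proof. by rewrite inner_S_Xn // subn0 inner_Phi_Xlast innerC. Qed.

Lemma inner_S_XnS n k : (k < n)%N -> inner w (S n) 'X^(k.+1) = 0.
Proof. by move=> kn; rewrite inner_S_Xn // inner_Phi_Xn ?rmorph0 //; lia. Qed.

Lemma inner_Phi_neq0 n : h n != 0.
Proof.
apply/eqP => /(inner_eq0 cw w_gt0) P0.
by have := size_Phi n; rewrite P0 size_poly0.
Qed.

(** Expanding the second argument of <P, P> in monomials, the constant term drops out by its
    coefficient and the others by orthogonality. *)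
Lemma poly_eq0_orthogonal n P : (size P <= n.+1)%N -> P`_0 = 0 ->
  (forall k, (k < n)%N -> inner w P 'X^(k.+1) = 0) -> P = 0.
Proof.
move=> sP P0 ortho; apply: (inner_eq0 cw w_gt0).
rewrite inner_sumr // big1 // => -[[|k] /= kP] _.
  by rewrite P0 rmorph0 mul0r.
by rewrite ortho ?mulr0 //; have := leq_trans kP sP.
Qed.

(** The leading terms cancel, so the difference has degree at most n; the constant terms cancel by
    the choice of [alpha n]; and each of the three terms is orthogonal to X, ..., X^n. *)
Lemma szego_recursion n : 'X * Phi n = Phi n.+1 + (alpha n)^* *: S n.
Proof.
apply/eqP; rewrite -subr_eq0; apply/eqP; apply: (@poly_eq0_orthogonal n).
- apply/leq_sizeP => j; rewrite leq_eqVlt => /orP[/eqP <-|nj].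
    rewrite coefB coefD coefXM coefZ /= !coef_Phi_lead coef_reversed ltnn.
    by rewrite mulr0 addr0 subrr.
  rewrite coefB coefD coefXM coefZ !nth_default ?size_Phi //.
  + by case: j nj => //= j nj; rewrite mulr0 addr0 subr0.
  + by rewrite (leq_trans (size_reversed _ _)) // ltnW.
  + by case: j nj.
- by rewrite coefB coefD coefXM coefZ coef0_S coef0_Phi mulr1 addNr subr0.
- move=> k kn; rewrite innerBl // innerDl // innerZl // inner_S_XnS // mulr0 addr0.
  by rewrite exprS innerXX inner_Phi_Xn // -exprS inner_Phi_Xn ?subr0.
Qed.

Lemma inner_XPhi_X0 n : inner w ('X * Phi n) 'X^0 = (alpha n)^* * h n.
Proof.
by rewrite szego_recursion innerDl // innerZl // inner_S_X0 inner_Phi_Xn // add0r.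
Qed.

Lemma inner_XPhi_XnS n k : (k < n)%N -> inner w ('X * Phi n) 'X^(k.+1) = 0.
Proof. by move=> kn; rewrite exprS innerXX inner_Phi_Xn. Qed.

(** This moment lies one beyond the range of [inner_S_Xn]. Seen in degree n+1, [S n] is the reversal
    of X [Phi n] and X^(n+1) that of 1, which reduces it to [inner_XPhi_X0]. *)
Lemma inner_S_Xlast n : inner w (S n) 'X^(n.+1) = alpha n * h n.
Proof.
rewrite -reversedXM ?size_Phi // -{2}(subn0 n.+1) -reversedXn //.
rewrite inner_reversed ?size_polyXn //; last first.
  by rewrite (leq_trans (size_polyMleq _ _)) // size_polyX size_Phi.
by rewrite -innerC // inner_XPhi_X0 rmorphM /= conjCK innerC.
Qed.

(** In the Szego recursion [Phi n.+2] drops out, and [Phi n.+1] sees only the top coefficient of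
    [S n.+1], which is [- alpha n]. *)
Lemma inner_XPhi_Phi n :
  inner w ('X * Phi n.+1) (Phi n.+1) = - (alpha n.+1)^* * alpha n * h n.+1.
Proof.
rewrite szego_recursion innerDl // innerZl // hPhi.2; last by lia.
rewrite -(innerC cw (Phi n.+1)) inner_Phi_lead ?size_reversed //.
by rewrite rmorphM /= conjCK coef_S_last (innerC cw); ring.
Qed.

End OPUC.

(** * The differential identities for the exponential weight *)

Section Weighted.
Variables (R : realType) (u : R[i]) (Phi : nat -> {poly R[i]}).
Hypothesis hPhi : monic_OPUC (weight u) Phi.

Local Notation w := (weight u).
Local Notation S n := (reversed n (Phi n)).
Local Notation alpha := (verblunsky Phi).

Let cw : continuous w := @continuous_weight R u.
Let w0 : forall t, 0 < w t := @weight_gt0 R u.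

Lemma size_Xderiv (f : {poly R[i]}) : (size ('X * f^`())%R <= size f)%N.
Proof.
apply/leq_sizeP => -[|j] sf; rewrite coefXM // coef_deriv nth_default //.
exact: mul0rn.
Qed.

(** Take f = g = [Phi n.+1] in [inner_weight_ibp]. Both derivative terms equal n+1 times the squared
    norm h, a real number, and cancel; what remains is -i h times the left-hand side, and h is
    nonzero. *)
Lemma verblunsky_imaginary n :
  u * (alpha n.+1)^* * alpha n + u^* * alpha n.+1 * (alpha n)^* = 0.
Proof.
have := inner_weight_ibp u (Phi n.+1) (Phi n.+1).
have sz : (size ('X * (Phi n.+1)^`())%R <= n.+2)%N.
  by rewrite -(size_Phi hPhi n.+1) size_Xderiv.
have E : inner w (Phi n.+1) ('X * (Phi n.+1)^`()) =
    n.+1%:R * inner w (Phi n.+1) (Phi n.+1).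
  rewrite (inner_Phi_lead cw hPhi sz) coefXM /= coef_deriv (coef_Phi_lead hPhi).
  by rewrite conjC_nat.
rewrite -(innerC cw (Phi n.+1) ('X * _^`())) E rmorphM /= conjC_nat innerC //.
rewrite -(innerC cw ('X * _) (Phi n.+1)) (inner_XPhi_Phi cw w0 hPhi).
have := inner_Phi_neq0 cw w0 hPhi n.+1.
have := innerC cw (Phi n.+1) (Phi n.+1).
move: (inner _ _ _) (alpha n) (alpha n.+1) => h a b hr h0 /eqP.
rewrite !rmorphM !rmorphN /= conjCK hr -subr_eq0 opprD addrA subrr sub0r oppr_eq0.
rewrite mulf_eq0 (negPf (neq0Ci _)) /= => /eqP H.
apply: (mulIf h0); rewrite mul0r -[RHS]oppr0 -H; ring.
Qed.

(** Monomials are eigenvectors of z d/dz, so the derivative on the second argument becomes the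
    factor k. *)
Lemma inner_Xderiv (f : {poly R[i]}) k :
  inner w ('X * f^`()) 'X^k = k%:R * inner w f 'X^k
    + 'i * (u * inner w ('X * f) 'X^k + u^* * inner w f 'X^(k.+1)).
Proof.
rewrite inner_weight_ibp -exprS; congr (_ + _).
have -> : 'X * 'X^k^`() = k%:R *: 'X^k :> {poly R[i]}.
  rewrite derivXn scaler_nat; case: k => [|k]; first by rewrite !mulr0n mulr0.
  by rewrite mulrnAr -exprS.
by rewrite innerZr // conjC_nat.
Qed.

(** Against X^(k+1) with k <= n, one X cancels and [inner_Xderiv] applies with exponent k. Its term
    k <Phi, X^k> vanishes, its conj(u) term is the one of [Phi n.+1] on the right, and its u term is
    that of X [S n.+1]. *)
Lemma deriv_Phi n :
  'X * ('X * (Phi n.+1)^`()) =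
    (n.+1%:R - 'i * u^* * alpha n.+1 * (alpha n)^*) *: ('X * Phi n.+1)
    + ('i * u^*) *: Phi n.+1
    + ('i * u * (alpha n.+1)^*) *: ('X * S n.+1)
    + ('i * u^* * (alpha n)^*) *: S n.+1.
Proof.
apply/eqP; rewrite -subr_eq0; apply/eqP.
apply: (@poly_eq0_orthogonal _ _ cw w0 n.+1).
- apply/leq_sizeP => j; rewrite leq_eqVlt => /orP[/eqP <-|nj].
    rewrite coefB !coefD !coefZ !coefXM /= coef_deriv !(coef_Phi_lead hPhi).
    rewrite coef_S_last !coef_reversed ltnn.
    rewrite (nth_default 0 (s := Phi n.+1)) ?(size_Phi hPhi) //.
    (* The coefficient of X^(n+2) in the difference is exactly i times the vanishing sum. *)
    apply: etrans (etrans (congr1 ( *%R 'i) (verblunsky_imaginary n)) (mulr0 _)); ring.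
  rewrite coefB !coefD !coefZ !coefXM; case: j nj => [|[|j]] //= nj.
  rewrite coef_deriv !nth_default ?(size_Phi hPhi) //; try lia.
  + by rewrite mul0rn !mulr0 !addr0 subrr.
  + by rewrite (leq_trans (size_reversed _ _)) //; lia.
  + by rewrite (leq_trans (size_reversed _ _)) //; lia.
- by rewrite coefB !coefD !coefZ !coefXM /= (coef0_S hPhi) coef0_Phi; ring.
- move=> k kn; rewrite innerBl // !innerDl // !innerZl //.
  rewrite (inner_S_XnS cw hPhi kn) (inner_XPhi_XnS cw hPhi kn).
  rewrite !(exprS _ k) !innerXX inner_Xderiv (inner_Phi_Xn cw hPhi kn) -exprS.
  (* Both sides vanish for 0 < k <= n; at k = 0 both are conj(alpha_(n+1)) times the squared
     norm. *)
  have XPhi : inner w ('X * Phi n.+1) 'X^k = (alpha n.+1)^* * inner w (S n.+1) 'X^k.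
    case: k kn => [|k] kn.
      by rewrite (inner_XPhi_X0 cw w0 hPhi) (inner_S_X0 cw hPhi).
    by rewrite (inner_XPhi_XnS cw hPhi) ?(inner_S_XnS cw hPhi) ?mulr0 // ltnW.
  by rewrite XPhi; ring.
Qed.

(** Compared with [deriv_Phi] the end coefficients change roles: that of X^(n+2) cancels
    identically, while the constant one needs [verblunsky_imaginary]. *)
Lemma deriv_reversed_Phi n :
  'X * (S n.+1)^`() =
    ('i * u * alpha n) *: ('X * Phi n.+1)
    + ('i * u^* * alpha n.+1) *: Phi n.+1
    + ('i * u) *: ('X * S n.+1)
    - ('i * u * (alpha n.+1)^* * alpha n) *: S n.+1.
Proof.
apply/eqP; rewrite -subr_eq0; apply/eqP.
apply: (@poly_eq0_orthogonal _ _ cw w0 n.+1).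
- apply/leq_sizeP => j; rewrite leq_eqVlt => /orP[/eqP <-|nj].
    rewrite !coefB !coefD !coefZ !coefXM /= coef_deriv coef_S_last.
    rewrite (coef_Phi_lead hPhi) !coef_reversed ltnn mul0rn.
    rewrite (nth_default 0 (s := Phi n.+1)) ?(size_Phi hPhi) //; ring.
  have S0 k : (n.+1 < k)%N -> (S n.+1)`_k = 0.
    by move=> nk; rewrite coef_reversed leqNgt nk.
  rewrite !coefB !coefD !coefZ !coefXM; case: j nj => // j nj /=.
  rewrite coef_deriv !S0 ?(ltnW nj) // !nth_default ?(size_Phi hPhi) ?(ltnW nj) //.
  by rewrite mul0rn !mulr0 !addr0 !subr0.
- rewrite !coefB !coefD !coefZ !coefXM /= (coef0_S hPhi) coef0_Phi.
  apply: etrans (etrans (congr1 ( *%R 'i) (verblunsky_imaginary n)) (mulr0 _)); ring.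
- move=> k kn; rewrite !innerBl // !innerDl // !innerZl //.
  rewrite inner_Xderiv (inner_S_XnS cw hPhi kn) (inner_XPhi_XnS cw hPhi kn).
  rewrite (exprS _ k) !innerXX -exprS.
  (* This turns the conj(u) term into that of [Phi n.+1]. Both sides vanish for k < n; at k = n the
     exponent n+2 calls for [inner_S_Xlast]. *)
  have -> : inner w (S n.+1) 'X^(k.+2) = alpha n.+1 * inner w (Phi n.+1) 'X^(k.+1).
    move: kn; rewrite ltnS leq_eqVlt => /orP[/eqP ->|kn].
      by rewrite (inner_S_Xlast cw w0 hPhi) (inner_Phi_Xlast cw hPhi).
    by rewrite (inner_S_XnS cw hPhi) // (inner_Phi_Xn cw hPhi) // mulr0.
  ring.
Qed.

End Weighted.

(** * Evaluation of the polynomial identities at a point *)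

Theorem theorem4p23 (R : realType) (u : R[i]) (Phi : nat -> {poly R[i]})
    (hPhi : monic_OPUC (weight u) Phi) (n : nat) (hn : (1 <= n)%N) (z : R[i]) :
  let alpha := verblunsky Phi in
  let PhiS := reversed n (Phi n) in
  z ^+ 2 * ((Phi n)^`()).[z] =
    ((n%:R - 'i * u^* * alpha n * (alpha n.-1)^*) * z + 'i * u^*) * (Phi n).[z]
    + ('i * u * (alpha n)^* * z + 'i * u^* * (alpha n.-1)^*) * PhiS.[z]
  /\
  z * (PhiS^`()).[z] =
    'i * (u * alpha n.-1 * z + u^* * alpha n) * (Phi n).[z]
    + 'i * u * (z - (alpha n)^* * alpha n.-1) * PhiS.[z].
Proof.
case: n hn => // n _ alpha PhiS; split; rewrite /alpha /PhiS /=.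
  have := congr1 (horner^~ z) (deriv_Phi hPhi n).
  by rewrite !(hornerD, hornerZ, hornerM, hornerX) mulrA -expr2 => ->; ring.
have := congr1 (horner^~ z) (deriv_reversed_Phi hPhi n).
by rewrite !(hornerD, hornerN, hornerZ, hornerM, hornerX) => ->; ring.
Qed.
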